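(* Let $X$ be a real Banach space, let $f: X \to \mathbb{R}\cup\{+\infty\}$ be a proper lower semicontinuous convex function, let $\ell\geq 0$ and let $S\subset X$ be a nonempty open and bounded set such that $\overline{S}\subset\operatorname{dom}f$. Then $f$ is $\ell$-Lipschitz on $S$ if and only if $f$ is locally $\ell$-Lipschitz with respect to $S$ at every point of $\operatorname{bd}(S)$, i.e., for every $x\in\operatorname{bd}(S)$ there exists $r>0$ such that $f$ is $\ell$-Lipschitz on $S\cap B(x;r)$.
   Context: $\overline{S}$ and $\operatorname{bd}(S)$ are the closure and boundary of $S$ in the norm topology of $X$, and $B(x;r)=\{y\in X:\|x-y\|<r\}$. For $f:X\to\mathbb{R}\cup\{+\infty\}$, $\operatorname{dom}f=\{x\in X: f(x)\in\mathbb{R}\}$; $f$ is proper if $\operatorname{dom} f\neq\emptyset$, convex (resp. lower semicontinuous) if its epigraph $\{(x,r)\in X\times\mathbb{R}: f(x)\le r\}$ is convex (resp. closed in $X\times\mathbb{R}$). $f$ is $\ell$-Lipschitz on a nonempty set $A\subset X$ if $f$ is finite on $A$ and $|f(x)-f(y)|\le \ell\|x-y\|$ for all $x,y\in A$. *)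

(* Defs.v *)
From HB Require Import structures.
From mathcomp Require Import all_boot all_order all_algebra.
From mathcomp Require Import all_classical all_reals all_analysis.
Set Implicit Arguments.
Unset Strict Implicit.
Unset Printing Implicit Defensive.
Import Order.TTheory GRing.Theory Num.Theory.
Import numFieldNormedType.Exports.
Local Open Scope classical_set_scope.
Local Open Scope ring_scope.

Definition boundary {T : topologicalType} (S : set T) : set T :=
  closure S `\` interior S.

Section extended_real_valued.
Context {R : realType} {X : normedModType R}.
Implicit Types (f : X -> \bar R) (A S : set X).

Definition dom f : set X := [set x | f x \is a fin_num].

Definition proper_fun f := dom f !=set0.

Definition epigraph f : set (X * R^o) := [set p | (f p.1 <= p.2%:E)%E].

Definition convex_efun f := convex_set (epigraph f).

(* Stated through the epigraph; the library's [lower_semicontinuous] is the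
   neighbourhood formulation. *)
Definition lsc_efun f := closed (epigraph f).

(* [fine] is junk at the infinities, hence the separate finiteness clause. *)
Definition elipschitz (l : R) f A :=
  A `<=` dom f /\ l.-lipschitz_A (fine \o f : X -> R^o).

Definition locally_elipschitz_wrt (l : R) f S (x : X) :=
  exists2 r : R, 0 < r & elipschitz l f (S `&` ball x r).

End extended_real_valued.

(* Main.v *)
Require Import Defs.
From mathcomp Require Import all_boot all_order all_algebra.
From mathcomp Require Import lra.
From mathcomp Require Import all_classical all_reals all_analysis.
Import Order.TTheory GRing.Theory Num.Theory.
Import numFieldNormedType.Exports.
Local Open Scope classical_set_scope.
Local Open Scope ring_scope.

(** To bound [f y - f x] by [l * `|y - x|] for [x] and [y] in [S], follow the
    ray from [x] through [y]. Since [S] is bounded, the points of [S] on the ray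
    have a farthest limit point [z] ([exit_point_on_ray]); as [S] is open, [z] is
    a boundary point lying strictly beyond [y]. The segment from [x] to [z] may
    well leave [S], but close to [z] the ray still contains a nondegenerate
    segment inside [S], and there the hypothesis at [z] bounds the slope of [f]
    by [l]. Slopes of a convex function increase along a line
    ([convex_slope_along_ray]), so the slope between [x] and [y], which comes
    earlier on the ray, is at most [l] too. Exchanging [x] and [y] gives the
    bound on [f x - f y]. *)

Lemma convex_efun_fine_le (R : realType) (X : normedModType R)
    (f : X -> \bar R) (x y : X) (a : R) :
  convex_efun f -> dom f x -> dom f y -> dom f (a *: x + (1 - a) *: y) ->
  0 <= a <= 1 ->
  fine (f (a *: x + (1 - a) *: y)) <= a * fine (f x) + (1 - a) * fine (f y).
Proof.
move=> fconv fx fy fxy a01.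
have i01a : Itv.spec (@Itv.num_sem R) (Itv.Real `[0%Z, 1%Z]) a.
  by rewrite /Itv.spec /Itv.num_sem /= num_real in_itv.
have gr z : dom f z -> ((z, fine (f z)) : convex_lmodType (X * R^o)%type)
    \in epigraph f.
  by move=> fz; apply/mem_set => /=; rewrite /epigraph /= fineK.
have := fconv _ _ (Itv.mk i01a) (gr x fx) (gr y fy).
by move/set_mem; rewrite /epigraph /= -{1}[f _]fineK // lee_fin.
Qed.

(** [x + s *: u] is the convex combination of [x + t *: u] and [x] with weights
    [s / t] and [1 - s / t]; clearing [t] keeps later uses free of division. *)
Lemma convex_chord_from_origin (R : realType) (X : normedModType R)
    (f : X -> \bar R) (x u : X) (s t : R) :
  convex_efun f -> dom f x -> dom f (x + s *: u) -> dom f (x + t *: u) ->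
  0 <= s <= t -> 0 < t ->
  t * (fine (f (x + s *: u)) - fine (f x)) <=
  s * (fine (f (x + t *: u)) - fine (f x)).
Proof.
move=> fconv fx fs ft /andP[s0 st] t0.
have st01 : 0 <= s / t <= 1.
  apply/andP; split.
    by rewrite divr_ge0// ltW.
  by rewrite ler_pdivrMr// mul1r.
have E : x + s *: u = (s / t) *: (x + t *: u) + (1 - s / t) *: x.
  rewrite scalerDr scalerA divfK ?gt_eqF// addrAC -scalerDl.
  by rewrite addrCA subrr addr0 scale1r.
have := @convex_efun_fine_le _ _ f (x + t *: u) x (s / t) fconv ft fx.
rewrite -E => /(_ fs st01).
have tst : t * (s / t) = s by rewrite mulrC divfK ?gt_eqF.
rewrite -(ler_pM2l t0) mulrDr [t * (s / t * _)]mulrA [t * ((1 - _) * _)]mulrA.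
by rewrite mulrBr mulr1 tst; lra.
Qed.

(** Monotonicity of slopes, obtained by comparing chords issued from [x] twice:
    the one to [x + u] with the one to [x + s *: u], then the latter with the
    one to [x + t *: u]. Only values at these four points enter, so [f] may be
    infinite elsewhere on the ray. *)
Lemma convex_slope_along_ray (R : realType) (X : normedModType R)
    (f : X -> \bar R) (x u : X) (s t : R) :
  convex_efun f -> dom f x -> dom f (x + u) -> dom f (x + s *: u) ->
  dom f (x + t *: u) -> 1 <= s <= t ->
  (t - s) * (fine (f (x + u)) - fine (f x)) <=
  fine (f (x + t *: u)) - fine (f (x + s *: u)).
Proof.
move=> fconv fx f1 fs ft /andP[s1 st].
have s0 : 0 < s by lra.
have := @convex_chord_from_origin _ _ f x u 1 s fconv fx.
rewrite scale1r ler01 mul1r => /(_ f1 fs s1 s0) le1s.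
have sst : 0 <= s <= t by lra.
have t0 : 0 < t by lra.
have lest := @convex_chord_from_origin _ _ f x u s t fconv fx fs ft sst t0.
rewrite -(ler_pM2l s0).
have : (t - s) * (s * (fine (f (x + u)) - fine (f x))) <=
       (t - s) * (fine (f (x + s *: u)) - fine (f x)).
  by rewrite ler_wpM2l // subr_ge0.
by lra.
Qed.

Lemma nbhs_gt_ex (R : realType) (s : R) (U : set R) :
  nbhs s U -> exists2 t, s < t & U t.
Proof.
move=> sU; have Us : \forall t \near s^'+, U t by exact: cvg_within sU.
by have [t [st Ut]] := filter_ex (filterI (nbhs_right_gt s) Us); exists t.
Qed.

Lemma ray_continuous (R : realType) (X : normedModType R) (x u : X) :
  continuous (fun t : R => x + t *: u).
Proof. by move=> t; apply: cvgD; [exact: cvg_cst|exact: scalel_continuous]. Qed.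

(** The exit parameter is the supremum of the parameters of points of [S] on the
    ray: it is a limit of such parameters, but is not one of them because these
    form an open set of reals. The limit must be taken along the ray, which is
    more than membership of the exit point in the closure of [S]: hence the
    last clause. *)
Lemma exit_point_on_ray (R : realType) (X : normedModType R) (S : set X)
    (x u : X) :
  open S -> bounded_set S -> u != 0 -> S (x + u) ->
  exists T : R, [/\ 1 < T, boundary S (x + T *: u) &
    closure [set t : R | S (x + t *: u)] T].
Proof.
move=> Sopen Sbnd u0 Sxu.
have raycont := @ray_continuous _ _ x u.
pose A := [set t : R | S (x + t *: u)].
have Aopen : open A by apply: (open_comp _ Sopen) => t _; exact: raycont.
have A1 : A 1 by rewrite /A /= scale1r.
have Aub : has_ubound A.
  have [M0 [_ /(_ (M0 + 1))]] := Sbnd; set M := M0 + 1 => SM.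
  have {}SM : forall v, S v -> `|v| <= M by apply: SM; rewrite ltrDl ltr01.
  exists ((M + `|x|) / `|u|) => t At.
  rewrite ler_pdivlMr ?normr_gt0//.
  have : t * `|u| <= `|t *: u| by rewrite normrZ ler_wpM2r// ler_norm.
  move/le_trans; apply.
  have -> : t *: u = (x + t *: u) - x by rewrite addrAC subrr add0r.
  by apply: (le_trans (ler_normB _ _)); rewrite lerD2r; exact: SM.
have nAT : ~ A (sup A).
  move=> AT; have [t Tt At] := nbhs_gt_ex _ _ _ (open_nbhs_nbhs (conj Aopen AT)).
  by have := ub_le_sup Aub At; rewrite leNgt Tt.
have T1 : 1 < sup A.
  rewrite lt_neqAle (ub_le_sup Aub A1) andbT.
  by apply/eqP => T1; apply: nAT; rewrite -T1.
have clT : closure A (sup A) by apply: closure_sup Aub; exists 1.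
exists (sup A); split => //; split; last by move/interior_subset.
by move=> B /raycont /clT[t [At Bt]]; exists (x + t *: u).
Qed.

Lemma le_of_locally_lipschitz_at_boundary (R : realType) (X : normedModType R)
    (f : X -> \bar R) (l : R) (S : set X) :
  convex_efun f -> open S -> bounded_set S -> S `<=` dom f ->
  (forall z, boundary S z -> locally_elipschitz_wrt l f S z) ->
  forall x y, S x -> S y -> fine (f y) - fine (f x) <= l * `|y - x|.
Proof.
move=> fconv Sopen Sbnd Sdom floc x y Sx Sy.
have [->|neq] := eqVneq y x; first by rewrite !subrr normr0 mulr0.
pose u := y - x.
have u0 : u != 0 by rewrite subr_eq0.
have yE : y = x + u by rewrite addrC subrK.
rewrite -/u yE; rewrite yE in Sy; clearbody u.
have [T [T1 bdT clT]] := @exit_point_on_ray _ _ S x u Sopen Sbnd u0 Sy.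
have [r r0 [_ lip]] := floc _ bdT.
have raycont := @ray_continuous _ _ x u.
pose U := [set t : R | (S `&` ball (x + T *: u) r) (x + t *: u)].
(* Points of [S] on the ray near the exit point give one parameter of [U]
   beyond 1; that [U] is open then gives a second one. *)
have [s s1 Us] : exists2 s, 1 < s & U s.
  have BT : nbhs T [set t : R | 1 < t /\ ball (x + T *: u) r (x + t *: u)].
    apply: filterI; first exact: lt_nbhsr.
    exact: (raycont T _ (nbhsx_ballx (x + T *: u) r r0)).
  by have [s [Ss [s1 Bs]]] := clT _ BT; exists s.
have Uopen : open U.
  apply: open_comp => [t _|]; first exact: raycont.
  by apply: openI => //; exact: ball_open.
have [t st Ut] := nbhs_gt_ex _ _ _ (open_nbhs_nbhs (conj Uopen Us)).
have [[Ss _] [St _]] := (Us, Ut).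
have st1 : 1 <= s <= t by rewrite !ltW.
have := @convex_slope_along_ray _ _ f x u s t fconv (Sdom _ Sx) (Sdom _ Sy)
  (Sdom _ Ss) (Sdom _ St) st1.
have := lip (x + t *: u, x + s *: u) (conj Ut Us).
rewrite /= opprD addrACA subrr add0r -scalerBl normrZ gtr0_norm ?subr_gt0//.
move=> /(le_trans (ler_norm _)) lelip /le_trans /(_ lelip).
by rewrite mulrCA ler_pM2l ?subr_gt0.
Qed.

Theorem theorem4p2 (R : realType) (X : completeNormedModType R)
    (f : X -> \bar R) (f_ninfty : forall x, f x <> -oo%E)
    (f_proper : proper_fun f) (f_lsc : lsc_efun f) (f_convex : convex_efun f)
    (l : R) (l_ge0 : 0 <= l)
    (S : set X) (S_neq0 : S !=set0) (S_open : open S)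
    (S_bounded : bounded_set S) (S_dom : closure S `<=` dom f) :
  elipschitz l f S <->
  (forall x, boundary S x -> locally_elipschitz_wrt l f S x).
Proof.
split=> [[Sdom lip] x _|floc].
  exists 1 => //; split=> [y [/Sdom//]|[y z] [[Sy _] [Sz _]]].
  exact: lip (y, z) (conj Sy Sz).
have Sdom : S `<=` dom f by move=> x Sx; exact/S_dom/subset_closure.
have le_f := @le_of_locally_lipschitz_at_boundary _ _ f l S
  f_convex S_open S_bounded Sdom floc.
split=> // -[x y] [/= Sx Sy].
by rewrite ler_norml -lerN2 opprK opprB {1}distrC !le_f.
Qed.
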